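(* There exist absolute constants $c>0$ and $C>0$ such that the following holds. For every integer $n\ge 1$, every known reference distribution $q$ over $[n]$, and all parameters $0<\varepsilon_2\le 1$ and $0\le \varepsilon_1\le c\,\varepsilon_2$, there is a tester which, given \[ m \le C\left( n\Big(\frac{\varepsilon_1}{\varepsilon_2^2}\Big)^2+n\,\frac{\varepsilon_1}{\varepsilon_2^2}+\frac{\sqrt n}{\varepsilon_2^{2}} \right) \] independent samples from an unknown distribution $p$ over $[n]$ (and the full description of $q$), distinguishes between $\|p-q\|_1\le \varepsilon_1$ and $\|p-q\|_1\ge \varepsilon_2$ with probability at least $4/5$, i.e. it outputs ''close'' with probability $\ge 4/5$ whenever $\|p-q\|_1\le\varepsilon_1$ and outputs ''far'' with probability $\ge 4/5$ whenever $\|p-q\|_1\ge\varepsilon_2$.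
   Context: $[n]=\{1,\dots,n\}$. A distribution over $[n]$ is a nonnegative vector $(p_1,\dots,p_n)$ with $\sum_i p_i=1$, and $\|p-q\|_1=\sum_i|p_i-q_i|$. The tester may be randomized; the $4/5$ success probability is over its randomness and the samples. *)

(* Defs.v *)
From HB Require Import structures.
From mathcomp Require Import all_boot all_order all_algebra.
From mathcomp Require Import Rstruct.
Set Implicit Arguments. Unset Strict Implicit. Unset Printing Implicit Defensive.
Import Order.TTheory GRing.Theory Num.Theory.
Local Open Scope ring_scope.

Definition is_distr (n : nat) (p : 'I_n -> Rdefinitions.R) : Prop :=
  (forall i, 0 <= p i) /\ \sum_(i < n) p i = 1.

Definition l1dist (n : nat) (p q : 'I_n -> Rdefinitions.R) : Rdefinitions.R :=
  \sum_(i < n) `|p i - q i|.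

(* A randomized tester using m samples is modelled by the function
   T : (sample sequence) -> [0,1], T s = probability (over the tester's
   internal randomness) of outputting "close" on samples s.
   accept_prob p T = probability of outputting "close" when the m samples
   are i.i.d. from p. *)
Definition accept_prob (n m : nat) (p : 'I_n -> Rdefinitions.R)
    (T : {ffun 'I_m -> 'I_n} -> Rdefinitions.R) : Rdefinitions.R :=
  \sum_(s : {ffun 'I_m -> 'I_n}) (\prod_(j < m) p (s j)) * T s.

(* Main.v *)
Require Import Defs.
From HB Require Import structures.
From mathcomp Require Import all_boot all_order all_algebra.
From mathcomp Require Import Rstruct.
From mathcomp Require Import ring lra zify.

(* [q] is flattened into the uniform distribution: symbol [i] is split into
   [floor (n q_i) + 1] grains, and half of each sample's mass is redirected so that [q]
   becomes uniform over the [N <= 2 n] grains while every l1 distance to [q] is exactly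
   halved. Uniformity is tested on a statistic [S = sum_x f(count_x)] with [f] convex.
   Since [f] is Lipschitz, moving [eps1] of mass changes [E S] by [O(m eps1)]; replacing the
   trials of a binomial one at a time shows that convexity makes a distribution at
   distance [eps2] increase [E S] by about [min (m^2 eps2^2 / (w N), m eps2)], where [w]
   is the scale on which [f] is curved. The variance is bounded by an Efron-Stein
   inequality. When [m <= N / 8], [S] counts collisions ([w = 1]) and its variance is at
   most [2 E S]; when [m >= N], [f] is a Huber function at scale [w = sqrt (m / N)]
   and the variance is [O(m)]. *)

Set Implicit Arguments. Unset Strict Implicit. Unset Printing Implicit Defensive.
Import Order.TTheory GRing.Theory Num.Theory.
Local Open Scope ring_scope.

(** * Binomial expectations and how they vary with the success probability *)

Section Binomial.
Variable R : realFieldType.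
Implicit Types (x u : R) (h : nat -> R).

(** Expectation of [h (k + X)] for [X] binomial with [m] trials of parameter [x]. Carrying the count
    in [k] lets nested calls express sums of trials with mixed parameters. *)
Fixpoint binE x m h k : R :=
  if m is m'.+1 then x * binE x m' h k.+1 + (1 - x) * binE x m' h k else h k.

Lemma eq_binE x m h1 h2 k : h1 =1 h2 -> binE x m h1 k = binE x m h2 k.
Proof. by move=> eh; elim: m k => [|m IHm] k /=; rewrite ?eh ?IHm. Qed.

Lemma binE_lin x m (a b : R) h1 h2 k :
  binE x m (fun j => a * h1 j + b * h2 j) k = a * binE x m h1 k + b * binE x m h2 k.
Proof. by elim: m k => [|m IHm] k //=; rewrite !IHm; ring. Qed.

Lemma binE_const x m a k : binE x m (fun=> a) k = a.
Proof. by elim: m k => [|m IHm] k //=; rewrite !IHm; ring. Qed.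

Lemma binE_affine x m a b h k : binE x m (fun j => a * h j + b) k = a * binE x m h k + b.
Proof.
rewrite -[in RHS](binE_const x m b k) -[X in _ + X]mul1r -binE_lin.
by apply: eq_binE => j; rewrite mul1r.
Qed.

Lemma binE_B x m h1 h2 k :
  binE x m (fun j => h1 j - h2 j) k = binE x m h1 k - binE x m h2 k.
Proof.
rewrite -[binE x m h1 k]mul1r -mulN1r -binE_lin.
by apply: eq_binE => j; rewrite mul1r mulN1r.
Qed.

Lemma binE_shift x m h k : binE x m h k.+1 = binE x m (fun j => h j.+1) k.
Proof. by elim: m k => [|m IHm] k //=; rewrite !IHm. Qed.

Lemma binE_add x l r h k : binE x l (binE x r h) k = binE x (l + r) h k.
Proof. by elim: l k => [|l IHl] k //=; rewrite !IHl. Qed.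

Lemma le_binE x m h1 h2 k : 0 <= x <= 1 -> (forall j, h1 j <= h2 j) ->
  binE x m h1 k <= binE x m h2 k.
Proof.
case/andP=> x0 x1 le_h; elim: m k => [|m IHm] k //=.
by apply: lerD; apply: ler_wpM2l; rewrite ?subr_ge0.
Qed.

Lemma binE_mean x m k : binE x m (fun j => j%:R) k = k%:R + m%:R * x.
Proof.
elim: m k => [|m IHm] k /=; first by ring.
by rewrite !IHm -!natr1; ring.
Qed.

Lemma binE_sqr x m a k :
  binE x m (fun j => (j%:R - a) ^+ 2) k = (k%:R + m%:R * x - a) ^+ 2 + m%:R * (x * (1 - x)).
Proof.
elim: m k => [|m IHm] k /=; first by ring.
by rewrite !IHm -!natr1; ring.
Qed.

(* Replace the trials of parameter [u] by trials of parameter [x] one at a time. *)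
Lemma binE_hybrid x u m h k : binE x m h k - binE u m h k =
  (x - u) * \sum_(l < m) binE x l (binE u (m.-1 - l) (fun j => h j.+1 - h j)) k.
Proof.
elim: m k => [|m IHm] k /=; first by rewrite big_ord0 mulr0 subrr.
rewrite big_ord_recl /= subn0 binE_B -binE_shift.
have -> : \sum_(i < m) binE x (bump 0 i) (binE u (m - bump 0 i) (fun j => h j.+1 - h j)) k =
  x * \sum_(l < m) binE x l (binE u (m.-1 - l) (fun j => h j.+1 - h j)) k.+1 +
  (1 - x) * \sum_(l < m) binE x l (binE u (m.-1 - l) (fun j => h j.+1 - h j)) k.
  rewrite !mulr_sumr -big_split /=; apply: eq_bigr => i _.
  by rewrite /bump /= add1n /= -subn1 -subnDA add1n.
have := IHm k.+1; have := IHm k.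
set s1 := \sum_(l < m) _; set s2 := \sum_(l < m) _ => e1 e2.
have -> : binE x m h k = binE u m h k + (x - u) * s1 by rewrite -e1; ring.
have -> : binE x m h k.+1 = binE u m h k.+1 + (x - u) * s2 by rewrite -e2; ring.
ring.
Qed.

Lemma le_norm_binE_diff x u m h k (b : R) : 0 <= x <= 1 -> 0 <= u <= 1 ->
  (forall j, 0 <= h j.+1 - h j <= b) ->
  `|binE x m h k - binE u m h k| <= b * m%:R * `|x - u|.
Proof.
move=> hx hu hb; rewrite binE_hybrid normrM mulrC ler_wpM2r //.
apply: le_trans (ler_norm_sum _ _ _) _.
have -> : b * m%:R = \sum_(l < m) b by rewrite sumr_const card_ord mulr_natr.
apply: ler_sum => l _.
have in0b j : 0 <= binE u (m.-1 - l) (fun i => h i.+1 - h i) j <= b.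
  apply/andP; split.
    rewrite -[leLHS](binE_const u (m.-1 - l) 0 j).
    by apply: le_binE => // i; case/andP: (hb i).
  rewrite -[leRHS](binE_const u (m.-1 - l) b j).
  by apply: le_binE => // i; case/andP: (hb i).
rewrite ger0_norm.
  rewrite -[leRHS](binE_const x l b k).
  by apply: le_binE => // j; case/andP: (in0b j).
rewrite -[leLHS](binE_const x l 0 k).
by apply: le_binE => // j; case/andP: (in0b j).
Qed.

(** The hybrid argument applied again, to the increments of [h]. The first-order part is kept apart
    because it cancels when summed over the cells of a distribution; the remainder averages second
    differences, so convexity gives it a sign. *)
Lemma binE_hybrid2 x u m h k :
  binE x m h k - binE u m h k
    - (x - u) * (m%:R * binE u m.-1 (fun j => h j.+1 - h j) k) =
  (x - u) ^+ 2 * \sum_(l < m) \sum_(i < l)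
    binE x i (binE u (m - 2 - i) (fun j => (h j.+2 - h j.+1) - (h j.+1 - h j))) k.
Proof.
rewrite binE_hybrid -mulrBr expr2 -mulrA; congr (_ * _).
set g := fun j => h j.+1 - h j.
have -> : m%:R * binE u m.-1 g k = \sum_(l < m) binE u m.-1 g k.
  by rewrite sumr_const card_ord mulr_natl.
rewrite -sumrB mulr_sumr; apply: eq_bigr => l _.
have le_lm : (l <= m.-1)%N by have := ltn_ord l; lia.
have -> : binE u m.-1 g k = binE u l (binE u (m.-1 - l) g) k by rewrite binE_add subnKC.
rewrite binE_hybrid.
congr (_ * _); apply: eq_bigr => i _; apply: eq_binE => j.
have -> : (m - 2 - i = l.-1 - i + (m.-1 - l))%N by have := ltn_ord i; lia.
rewrite -binE_add; apply: eq_binE => r.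
by rewrite binE_shift -binE_B.
Qed.

Lemma sqr_binE_le x m h k : 0 <= x <= 1 -> (binE x m h k) ^+ 2 <= binE x m (fun j => h j ^+ 2) k.
Proof.
move=> hx; set a := binE x m h k.
have : binE x m (fun=> 0) k <= binE x m (fun j => 1 * h j ^+ 2 + (- a * 2) * h j + a ^+ 2) k.
  by apply: le_binE => // j; rewrite (_ : _ + _ = (h j - a) ^+ 2) ?sqr_ge0 //; ring.
rewrite binE_const.
have -> : binE x m (fun j => 1 * h j ^+ 2 + - a * 2 * h j + a ^+ 2) k =
  1 * binE x m (fun j => 1 * h j ^+ 2 + - a * 2 * h j) k + a ^+ 2.
  by rewrite -binE_affine; apply: eq_binE => j; ring.
by rewrite binE_lin -/a; nra.
Qed.

(** For [x != u], the double sum of [binE_hybrid2] has at least of order [m * min (m, r / |x - u|)]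
    terms that the window hypothesis bounds below; convexity makes the others nonnegative. *)
Lemma binE_gap x u m h (w r : R) : 0 <= x <= 1 -> 0 <= u <= 1 -> (1 < m)%N -> 0 < w -> 0 < r ->
  (forall j, 0 <= (h j.+2 - h j.+1) - (h j.+1 - h j)) ->
  (forall i : nat, (i <= m - 2)%N -> i%:R * `|x - u| <= r ->
     (2 * w)^-1 <= binE x i (binE u (m - 2 - i) (fun j => (h j.+2 - h j.+1) - (h j.+1 - h j))) 0) ->
  Num.min (m%:R ^+ 2 * (x - u) ^+ 2) (m%:R * r * `|x - u|) <=
    8 * w * (binE x m h 0 - binE u m h 0
       - (x - u) * (m%:R * binE u m.-1 (fun j => h j.+1 - h j) 0)).
Proof.
move=> hx hu m1 w0 r0 cvx win; rewrite binE_hybrid2.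
set D := fun j => _ in win *.
set d := `|x - u|; have d0 : 0 <= d by exact: normr_ge0.
have -> : (x - u) ^+ 2 = d ^+ 2 by rewrite real_normK ?num_real.
set t := Num.min (m%:R * d) r.
have t0 : 0 <= t by rewrite le_min (ltW r0) mulr_ge0.
have tm : t <= m%:R * d by rewrite ge_min lexx.
have tr : t <= r by rewrite ge_min lexx orbT.
have -> : Num.min (m%:R ^+ 2 * d ^+ 2) (m%:R * r * d) = m%:R * d * t.
  by rewrite /t minr_pMr ?mulr_ge0 //; congr (Num.min _ _); ring.
have mR : 2 <= m%:R :> R by rewrite (ler_nat R 2).
have Dge0 i l k : 0 <= binE x i (binE u l D) k.
  rewrite -[leLHS](binE_const x i 0 k); apply: le_binE => // j.
  by rewrite -[leLHS](binE_const u l 0 j); apply: le_binE.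
have w20 : 0 < (2 * w)^-1 by rewrite invr_gt0 mulr_gt0.
(* Only the hybrids with few [x]-trials are used: their mean stays close to [m * u]. *)
have count l : (l < m)%N -> Num.min (l%:R * d) r * (2 * w)^-1 <=
    d * \sum_(i < l) binE x i (binE u (m - 2 - i) D) 0.
  elim: l => [|l IHl] lm.
    by rewrite mul0r big_ord0 mulr0 min_l ?mul0r // ltW.
  rewrite big_ord_recr /= mulrDr; set b := binE x l _ 0.
  have [ldr|rld] := leP (l%:R * d) r.
    have := IHl (ltnW lm); rewrite min_l // => IH.
    have wb : (2 * w)^-1 <= b by apply: win => //; clear -lm; lia.
    have := ler_wpM2l d0 wb; rewrite -natr1 => db.
    apply: le_trans (lerD IH db); rewrite -mulrDl ler_pM2r //.
    by rewrite ge_min; apply/orP; left; lra.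
  have := IHl (ltnW lm); rewrite min_r ?(ltW rld) // => IH.
  rewrite -[leLHS]addr0; apply: lerD; last by rewrite mulr_ge0 ?Dge0.
  by apply: le_trans IH; rewrite ler_pM2r // ge_min lexx orbT.
(* For [l <= m], [m * min (l * d, r) >= l * min (m * d, r)], which turns the sum over [l] into an
   arithmetic series. *)
have inner (l : 'I_m) : l%:R * t * (2 * w)^-1 <=
    m%:R * d * \sum_(i < l) binE x i (binE u (m - 2 - i) D) 0.
  rewrite -mulrA; apply: le_trans (_ : m%:R * (Num.min (l%:R * d) r * (2 * w)^-1) <= _); last first.
    by rewrite -mulrA; apply: ler_wpM2l => //; exact: count.
  rewrite !mulrA ler_pM2r //.
  have lm : l%:R <= m%:R :> R by rewrite ler_nat; exact/ltnW/ltn_ord.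
  rewrite [leRHS]minr_pMr // le_min; apply/andP; split.
    by rewrite mulrCA ler_wpM2l.
  exact: ler_pM.
have : \sum_(l < m) l%:R * t * (2 * w)^-1 <=
    \sum_(l < m) m%:R * d * \sum_(i < l) binE x i (binE u (m - 2 - i) D) 0.
  by apply: ler_sum.
rewrite -!mulr_suml -mulr_sumr.
set sum2 := \sum_(l < m) \sum_(i < l) _.
have -> : \sum_(i < m) i%:R = m%:R * (m%:R - 1) / 2 :> R.
  elim: (m) => [|k IHk]; first by rewrite big_ord0 !mul0r.
  by rewrite big_ord_recr /= IHk -natr1; field.
move=> le_sum2.
have m0 : 0 < m%:R :> R by lra.
have le_t : 2 * (m%:R - 1) * t <= 8 * w * d * sum2.
  rewrite -(ler_pM2l m0); apply: le_trans (_ : 8 * w * (m%:R * d * sum2) <= _); last first.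
    by rewrite le_eqVlt; apply/orP; left; apply/eqP; ring.
  apply: le_trans (ler_wpM2l _ le_sum2); last by lra.
  by rewrite le_eqVlt; apply/orP; left; apply/eqP; field; rewrite gt_eqF.
have : m%:R * t <= 8 * w * d * sum2.
  by apply: le_trans le_t; rewrite ler_wpM2r //; lra.
move=> /(ler_wpM2l d0) le_dt.
have -> : m%:R * d * t = d * (m%:R * t) by ring.
by apply: le_trans le_dt _; rewrite le_eqVlt; apply/orP; left; apply/eqP; ring.
Qed.
End Binomial.

(** * Histograms of i.i.d. samples: variance and tail bounds *)

Section Multinomial.
Variables (R : realFieldType) (I : finType).
Implicit Types (p : I -> R) (c : I -> nat) (F G : (I -> nat) -> R) (f g : nat -> R).

Definition incr c i : I -> nat := fun x => (c x + (x == i))%N.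

Lemma incr_id c i : incr c i i = (c i).+1.
Proof. by rewrite /incr eqxx addn1. Qed.

Lemma incr_neq c i j : j != i -> incr c i j = c j.
Proof. by rewrite /incr => /negPf->; rewrite addn0. Qed.

(* Expectation of [F] of the histogram [c] augmented by [m] samples from [p]. *)
Fixpoint multE p m F c : R :=
  if m is m'.+1 then \sum_i p i * multE p m' F (incr c i) else F c.

Definition distr p := (forall i, 0 <= p i) /\ \sum_i p i = 1.

Lemma eq_multE p m F G c : F =1 G -> multE p m F c = multE p m G c.
Proof.
by move=> eF; elim: m c => [|m IHm] c //=; apply: eq_bigr => i _; rewrite IHm.
Qed.

Lemma multE_lin p m (a b : R) F G c :
  multE p m (fun s => a * F s + b * G s) c = a * multE p m F c + b * multE p m G c.
Proof.
elim: m c => [|m IHm] c //=.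
rewrite !mulr_sumr -big_split /=; apply: eq_bigr => i _; rewrite IHm; ring.
Qed.

Lemma multE_sum p m (J : finType) (H : J -> (I -> nat) -> R) c :
  multE p m (fun s => \sum_j H j s) c = \sum_j multE p m (H j) c.
Proof.
elim: m c => [|m IHm] c //=; rewrite exchange_big; apply: eq_bigr => i _.
by rewrite IHm mulr_sumr.
Qed.

Section Distr.
Variables (p : I -> R) (pD : distr p).
Let p_ge0 : forall i, 0 <= p i := pD.1.

Lemma distr_le1 i : 0 <= p i <= 1.
Proof.
rewrite p_ge0 -pD.2 (bigD1 i) //= lerDl; exact: sumr_ge0.
Qed.

Lemma multE_const m a c : multE p m (fun=> a) c = a.
Proof.
elim: m c => [|m IHm] c //=; rewrite -[RHS]mul1r -pD.2 mulr_suml.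
by apply: eq_bigr => i _; rewrite IHm.
Qed.

Lemma multE_affine m a b F c : multE p m (fun s => a * F s + b) c = a * multE p m F c + b.
Proof.
rewrite -[in RHS](multE_const m b c) -[X in _ + X]mul1r -multE_lin.
by apply: eq_multE => s; rewrite mul1r.
Qed.

Lemma le_multE m F G c : (forall s, F s <= G s) -> multE p m F c <= multE p m G c.
Proof.
move=> leFG; elim: m c => [|m IHm] c //=.
by apply: ler_sum => i _; apply: ler_wpM2l.
Qed.

(** Each sample hits cell [i] with probability [p i] and otherwise leaves its count alone, so a
    single count is binomial. *)
Lemma multE_coord m f i c : multE p m (fun s => f (s i)) c = binE (p i) m f (c i).
Proof.
elim: m c => [|m IHm] c //=.
rewrite (bigD1 i) //= IHm incr_id; congr (_ + _).
have -> : 1 - p i = \sum_(j | j != i) p j 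
  by apply/eqP; rewrite subr_eq -pD.2 (bigD1 i) //= addrC.
rewrite mulr_suml; apply: eq_bigr => j ji.
by rewrite IHm incr_neq // eq_sym.
Qed.

Lemma multE_shift_sqr m (a : R) F c :
  multE p m (fun s => (F s - a) ^+ 2) c =
  multE p m (fun s => (F s - multE p m F c) ^+ 2) c + (multE p m F c - a) ^+ 2.
Proof.
set mu := multE p m F c.
rewrite (@eq_multE _ _ _ (fun s => 1 * (F s - mu) ^+ 2 + 1 *
    (2 * (mu - a) * F s + (a ^+ 2 - mu ^+ 2)))); last by move=> s; ring.
rewrite multE_lin multE_affine -/mu; ring.
Qed.

Definition stat f (s : I -> nat) : R := \sum_x f (s x).

Lemma multE_stat m f c : multE p m (stat f) c = \sum_x binE (p x) m f (c x).
Proof. by rewrite multE_sum; apply: eq_bigr => x _; rewrite multE_coord. Qed.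

(* An Efron-Stein inequality: [f k - f k.-1] is the effect of deleting one sample
   from a cell containing [k] of them. *)
Lemma var_stat m f c :
  multE p m (fun s => (stat f s - multE p m (stat f) c) ^+ 2) c <=
  multE p m (fun s => \sum_x ((s x)%:R - (c x)%:R) * (f (s x) - f (s x).-1) ^+ 2) c.
Proof.
elim: m c => [|m IHm] c /=.
  by rewrite subrr expr0n big1 // => x _; rewrite subrr mul0r.
set mu := \sum_i p i * multE p m (stat f) _; set nu := multE p m (stat f) c.
pose mui i := multE p m (stat f) (incr c i).
have muE : mu = \sum_i p i * mui i by [].
(* Law of total variance, conditioning on the first sample. *)
have -> : \sum_i p i * multE p m (fun s => (stat f s - mu) ^+ 2) (incr c i) =
  \sum_i p i * multE p m (fun s => (stat f s - mui i) ^+ 2) (incr c i) +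
  \sum_i p i * (mui i - mu) ^+ 2.
  rewrite -big_split; apply: eq_bigr => i _ /=.
  by rewrite multE_shift_sqr -mulrDr.
(* Recentring at [nu], the mean without the first sample, leaves a negative square that is dropped
   below. *)
have -> : \sum_i p i * (mui i - mu) ^+ 2 = \sum_i p i * (mui i - nu) ^+ 2 - (mu - nu) ^+ 2.
  rewrite [in RHS](eq_bigr (fun i => p i * (mui i - mu) ^+ 2 + (p i * mui i * (2 * (mu - nu))
     + p i * (nu ^+ 2 - mu ^+ 2)))); last by move=> i _; ring.
  rewrite !big_split /= -!mulr_suml -muE pD.2; ring.
(* The extra sample changes only cell [i], so the two means differ by an expected increment
   there. *)
have inc i : mui i - nu = multE p m (fun s => f (s i) - f (s i).-1) (incr c i).
  rewrite /mui /nu !multE_stat (multE_coord m (fun k => f k - f k.-1)) incr_id binE_shift /= binE_B.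
  rewrite (bigD1 i) // [in X in _ - X](bigD1 i) //= incr_id binE_shift.
  rewrite opprD addrACA -sumrB big1 ?addr0 // => j ji.
  by rewrite incr_neq // subrr.
have sqr_inc i : (mui i - nu) ^+ 2 <= multE p m (fun s => (f (s i) - f (s i).-1) ^+ 2) (incr c i).
  rewrite inc (multE_coord _ (fun k => f k - f k.-1)) (multE_coord _ (fun k => (f k - f k.-1) ^+ 2)).
  exact: sqr_binE_le (distr_le1 i).
rewrite addrA; apply: le_trans (_ : _ <= \sum_i (p i * multE p m (fun s => (stat f s - mui i) ^+ 2) (incr c i) + p i * (mui i - nu) ^+ 2)) _.
  by rewrite big_split /= lerBlDr lerDl sqr_ge0.
apply: ler_sum => i _; rewrite -mulrDr; apply: ler_wpM2l => //.
apply: le_trans (lerD (IHm _) (sqr_inc i)) _.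
rewrite -[X in X + _]mul1r -[X in _ + X]mul1r -multE_lin le_eqVlt; apply/orP; left; apply/eqP.
apply: eq_multE => s; rewrite !mul1r.
(* The squared increment supplies the unit by which [incr c i] exceeds [c] in cell [i]. *)
rewrite (bigD1 i) // [in RHS](bigD1 i) //= addrAC; congr (_ + _).
  by rewrite incr_id -natr1; ring.
by apply: eq_bigr => j ji; rewrite incr_neq.
Qed.

Lemma chebyshev m F (t : R) c : 0 < t ->
  multE p m (fun s => (t <= `|F s - multE p m F c|)%R%:R) c <=
  multE p m (fun s => (F s - multE p m F c) ^+ 2) c / t ^+ 2.
Proof.
move=> t0; set mu := multE p m F c; rewrite mulrC -[leRHS]addr0 -multE_affine.
apply: le_multE => s; rewrite addr0.
case: (boolP (t <= `|F s - mu|)) => [tF|_]; last first.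
  by rewrite mulr_ge0 ?sqr_ge0 // invr_ge0 sqr_ge0.
rewrite mulrC ler_pdivlMr ?exprn_gt0 // mul1r -[leRHS]real_normK ?num_real //.
by rewrite ler_pXn2r ?nnegrE // ltW.
Qed.

Lemma threshold_above m F (tau t v : R) c : 0 < t ->
  multE p m (fun s => (F s - multE p m F c) ^+ 2) c <= v ->
  multE p m F c + t <= tau ->
  1 - v / t ^+ 2 <= multE p m (fun s => (F s <= tau)%R%:R) c.
Proof.
move=> t0 le_v le_tau; have := chebyshev m F c t0; set mu := multE p m F c in le_tau *.
move=> /le_trans/(_ (ler_wpM2r _ le_v)); rewrite invr_ge0 sqr_ge0 => /(_ isT) cheb.
apply: le_trans (_ : 1 - multE p m (fun s => (t <= `|F s - mu|)%R%:R) c <= _); first by lra.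
rewrite addrC -mulN1r -multE_affine; apply: le_multE => s.
case: (lerP (F s) tau) => [_|lt_tau]; first by case: (t <= _)%R; rewrite /=; lra.
by rewrite (_ : (t <= _)%R) ?mulr1 ?addNr //; apply: le_trans (ler_norm _); lra.
Qed.

Lemma threshold_below m F (tau t v : R) c : 0 < t ->
  multE p m (fun s => (F s - multE p m F c) ^+ 2) c <= v ->
  tau + t <= multE p m F c ->
  multE p m (fun s => (F s <= tau)%R%:R) c <= v / t ^+ 2.
Proof.
move=> t0 le_v le_tau; have := chebyshev m F c t0; set mu := multE p m F c in le_tau *.
move=> /le_trans/(_ (ler_wpM2r _ le_v)); rewrite invr_ge0 sqr_ge0 => /(_ isT).
apply: le_trans; apply: le_multE => s; case: (lerP (F s) tau) => // le_F.
rewrite (_ : (t <= _)%R) //; rewrite distrC; apply: le_trans (ler_norm _); lra.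
Qed.
End Distr.
End Multinomial.

(** * Mean and variance of a statistic, compared with the uniform distribution *)

Section MeanGap.
Variables (R : realFieldType) (I : finType).
Hypothesis I0 : (0 < #|I|)%N.
Let N : R := #|I|%:R.
Let u : R := N^-1.
Implicit Types (p : I -> R) (f : nat -> R).

Let N0 : 0 < N.
Proof. by rewrite ltr0n. Qed.

Lemma unif_prob : 0 <= u <= 1.
Proof. by rewrite invr_ge0 ltW //= invf_le1 // (ler_nat R 1). Qed.

Lemma distr_unif : distr (fun _ : I => u).
Proof.
split=> [i|]; first by rewrite invr_ge0 ltW.
by rewrite sumr_const -[_ *+ _]mulr_natr mulVf // gt_eqF.
Qed.

Definition mean_stat p m f := multE p m (stat f) (fun _ : I => 0%N).

Lemma mean_statE p m f : distr p -> mean_stat p m f = \sum_x binE (p x) m f 0.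
Proof. by move=> pD; rewrite /mean_stat multE_stat. Qed.

Lemma mean_stat_unif m f : mean_stat (fun=> u) m f = N * binE u m f 0.
Proof. by rewrite (mean_statE _ _ distr_unif) sumr_const mulr_natl. Qed.

Lemma mean_stat_close p m f (b : R) : distr p -> (forall k, 0 <= f k.+1 - f k <= b) ->
  mean_stat p m f - mean_stat (fun=> u) m f <= b * m%:R * \sum_x `|p x - u|.
Proof.
move=> pD fb; rewrite !mean_statE //; last exact: distr_unif.
rewrite -sumrB mulr_sumr; apply: ler_sum => x _.
apply: le_trans (ler_norm _) _; apply: le_norm_binE_diff => //.
  exact: distr_le1.
exact: unif_prob.
Qed.

(** [binE_gap] is summed over the cells; its first-order terms cancel because [p] and the uniform
    distribution have the same total mass. *)
Lemma mean_stat_far p m f (w r e : R) : distr p -> (1 < m)%N -> 0 < w -> 0 < r -> 0 < e ->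
  (forall j, 0 <= (f j.+2 - f j.+1) - (f j.+1 - f j)) ->
  (forall x (i : nat), 0 <= x <= 1 -> (i <= m - 2)%N -> i%:R * `|x - u| <= r ->
     (2 * w)^-1 <= binE x i (binE u (m - 2 - i) (fun j => (f j.+2 - f j.+1) - (f j.+1 - f j))) 0) ->
  e <= \sum_x `|p x - u| ->
  Num.min (m%:R ^+ 2 * e ^+ 2 / N) (m%:R * r * e / 2) <=
    8 * w * (mean_stat p m f - mean_stat (fun=> u) m f).
Proof.
move=> pD m1 w0 r0 e0 cvx win le_e.
have m0 : 0 < m%:R :> R by rewrite ltr0n; apply: leq_trans m1.
(* With [d = |p x - u|], both branches of a cell's minimum are at least
   [2 * m ^+ 2 * th * d - m ^+ 2 * th ^+ 2]: the first since [(d - th) ^+ 2 >= 0], the second since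
   [2 * m * th <= r]. Summing this linear minorant uses [th * N <= e]. *)
pose th := Num.min (e / N) (r / (2 * m%:R)).
have th_e : th * N <= e by rewrite -ler_pdivlMr // ge_min lexx.
have th_r : 2 * m%:R * th <= r by rewrite mulrC -ler_pdivlMr ?ge_min ?lexx ?orbT // mulr_gt0.
have th0 : 0 < th by rewrite lt_min !divr_gt0 // mulr_gt0.
have -> : Num.min (m%:R ^+ 2 * e ^+ 2 / N) (m%:R * r * e / 2) = m%:R ^+ 2 * e * th.
  rewrite minr_pMr ?mulr_ge0 ?sqr_ge0 ?(ltW e0) //; congr Num.min; field; rewrite ?gt_eqF //.
have -> : mean_stat p m f - mean_stat (fun=> u) m f =
  \sum_x (binE (p x) m f 0 - binE u m f 0
     - (p x - u) * (m%:R * binE u m.-1 (fun j => f j.+1 - f j) 0)).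
  rewrite !mean_statE //; last exact: distr_unif.
  by rewrite !sumrB -mulr_suml sumrB pD.2 (distr_unif.2) subrr mul0r subr0.
rewrite mulr_sumr; apply: le_trans (_ : \sum_x (2 * m%:R ^+ 2 * th * `|p x - u| - m%:R ^+ 2 * th ^+ 2) <= _).
  rewrite sumrB -mulr_sumr sumr_const -[_ *+ #|_|]mulr_natr -/N.
  have := ler_wpM2l (ltW th0) le_e; have := ler_wpM2l (ltW th0) th_e.
  set l1 := \sum_x _; have := exprn_gt0 2 m0; set M := m%:R ^+ 2 => M0 h1 h2.
  have := ler_wpM2l (ltW M0) h1; have := ler_wpM2l (ltW M0) h2; lra.
apply: ler_sum => x _.
apply: le_trans (binE_gap (distr_le1 pD x) unif_prob m1 w0 r0 cvx _); last first.
  by move=> i; apply: win; apply: distr_le1.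
have -> : (p x - u) ^+ 2 = `|p x - u| ^+ 2 by rewrite real_normK ?num_real.
have := normr_ge0 (p x - u); move: `|p x - u| => d d0.
rewrite le_min; apply/andP; split.
  have := mulr_ge0 (sqr_ge0 (m%:R : R)) (sqr_ge0 (d - th)); nra.
have := ler_wpM2l (mulr_ge0 (ltW m0) d0) th_r.
have := sqr_ge0 (m%:R * th); nra.
Qed.

Lemma var_stat_lipschitz p m f (b : R) : distr p -> 0 <= b -> (forall k, 0 <= f k.+1 - f k <= b) ->
  multE p m (fun s => (stat f s - mean_stat p m f) ^+ 2) (fun=> 0%N) <= b ^+ 2 * m%:R.
Proof.
move=> pD b0 fb; apply: le_trans (var_stat pD m f _) _.
apply: le_trans (_ : multE p m (fun s => b ^+ 2 * (stat (fun k => k%:R) s) + 0) (fun=> 0%N) <= _).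
  apply: le_multE => // s; rewrite addr0 mulr_sumr; apply: ler_sum => x _.
  rewrite subr0 mulrC; apply: ler_wpM2r => //; case: (s x) => [|k] /=.
    by rewrite subrr expr0n sqr_ge0.
  by case/andP: (fb k) => h1 h2; rewrite ler_pXn2r ?nnegrE.
rewrite multE_affine // addr0 multE_stat // (eq_bigr (fun x => m%:R * p x)) => [|x _].
  by rewrite -mulr_sumr pD.2 mulr1.
by rewrite binE_mean add0r.
Qed.

(** A cell with [k] samples adds [k] to the Efron-Stein bound if [k >= 2] and nothing otherwise, and
    then [k <= 2 * (k - 1)]. *)
Lemma var_collisions p m (f := fun k => k.-1%:R) : distr p ->
  multE p m (fun s => (stat f s - mean_stat p m f) ^+ 2) (fun=> 0%N) <= 2 * mean_stat p m f.
Proof.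
move=> pD; apply: le_trans (var_stat pD m f _) _.
rewrite -[leRHS]addr0 -multE_affine //; apply: le_multE => // s.
rewrite addr0 mulr_sumr; apply: ler_sum => x _; rewrite subr0 /f.
case: (s x) => [|[|k]] /=; first by rewrite mul0r mulr0.
  by rewrite subrr expr0n !mulr0.
by rewrite -!natr1; have := ler0n R k; nra.
Qed.

(** [k.-1] is at most [k ^ 2 - k], whose binomial mean is [m * (m - 1) * u ^ 2]. *)
Lemma mean_collisions_unif m : mean_stat (fun=> u) m (fun k => k.-1%:R) <= m%:R ^+ 2 / N.
Proof.
rewrite mean_stat_unif.
apply: le_trans (_ : N * binE u m (fun k => 1 * (k%:R - 0) ^+ 2 + (-1) * k%:R) 0 <= _).
  apply: ler_wpM2l; first exact: ltW.
  apply: le_binE; first exact: unif_prob.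
  case=> [|[|k]] /=; first by rewrite subr0 expr0n /=; lra.
    by rewrite subr0 expr1n; lra.
  by rewrite -!natr1; have := ler0n R k; nra.
rewrite binE_lin binE_sqr binE_mean.
have -> : N * (1 * ((0%:R + m%:R * u - 0) ^+ 2 + m%:R * (u * (1 - u))) + -1 * (0%:R + m%:R * u)) =
  m%:R ^+ 2 / N * (N * u) - m%:R * u * (N * u) by rewrite /u; field; rewrite gt_eqF.
rewrite /u divff ?gt_eqF // !mulr1 lerBlDr lerDl mulr_ge0 // invr_ge0 ltW //.
Qed.

(** A sum of independent Bernoulli variables has variance at most its mean. *)
Lemma binE_hybrid_sqr x i r (mu := i%:R * x + r%:R * u) : 0 <= x <= 1 ->
  binE x i (binE u r (fun j => (j%:R - mu) ^+ 2)) 0 <= mu.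
Proof.
move=> /andP[x0 x1]; case/andP: unif_prob => u0 u1.
rewrite (@eq_binE _ _ _ _ (fun k => 1 * (k%:R - (mu - r%:R * u)) ^+ 2 + r%:R * (u * (1 - u)))).
  rewrite binE_affine binE_sqr add0r /mu.
  have := ler0n R i; have := ler0n R r; nra.
by move=> k; rewrite binE_sqr; ring.
Qed.

Lemma binE_hybrid_mean x i r : binE x i (binE u r (fun j => j%:R)) 0 = i%:R * x + r%:R * u.
Proof.
rewrite (@eq_binE _ _ _ _ (fun k => 1 * k%:R + r%:R * u)) ?binE_affine ?binE_mean; first ring.
by move=> k; rewrite binE_mean; ring.
Qed.

End MeanGap.

(** * Threshold testers for uniformity with few and with many samples per cell *)

Section Regimes.
Variables (R : realFieldType) (I : finType).
Hypothesis I0 : (0 < #|I|)%N.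
Let N : R := #|I|%:R.
Let u : R := N^-1.
Implicit Types (p : I -> R) (f : nat -> R).

Let N0 : 0 < N.
Proof. by rewrite ltr0n. Qed.

Definition separates m (T : (I -> nat) -> R) (e1 e2 : R) := forall p, distr p ->
  (\sum_x `|p x - N^-1| <= e1 -> 4 / 5 <= multE p m T (fun=> 0%N)) /\
  (e2 <= \sum_x `|p x - N^-1| -> multE p m T (fun=> 0%N) <= 1 / 5).

(** The second difference of [k.-1] is the indicator of an empty cell, and the hybrid mean count is
    at most [1 / 4 + 1 / 8], so Markov's inequality gives probability at least one half. *)
Lemma collisions_window m x (i : nat) (f := fun k => k.-1%:R : R) :
  8 * m%:R <= N -> (1 < m)%N -> 0 <= x <= 1 -> (i <= m - 2)%N -> i%:R * `|x - u| <= 1 / 4 ->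
  (2 * 1)^-1 <= binE x i (binE u (m - 2 - i) (fun j => (f j.+2 - f j.+1) - (f j.+1 - f j))) 0.
Proof.
move=> mN m1 hx im le_i; have hu : 0 <= u <= 1 := unif_prob R I0.
have -> : (2 * 1)^-1 = 2^-1 :> R by rewrite mulr1.
set r := (m - 2 - i)%N.
apply: le_trans (_ : binE x i (binE u r (fun j => -1 * j%:R + 1)) 0 <= _).
  rewrite (@eq_binE _ _ _ _ (fun j => -1 * binE u r (fun j => j%:R) j + 1)); last first.
    by move=> j; rewrite binE_affine.
  rewrite binE_affine binE_hybrid_mean -/N -/u.
  have ir : (i + r + 2 = m)%N by rewrite /r; clear -im m1; lia.
  have : i%:R + r%:R + 2 = m%:R :> R by rewrite -!natrD ir.
  have := ler_norm (x - u); move/(ler_wpM2l (ler0n R i)).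
  have : m%:R * u <= 1 / 8 by rewrite ler_pdivrMr //; lra.
  have : 0 <= u by case/andP: hu.
  move=> u0 mu8 ix irE.
  have : (i%:R + r%:R + 2) * u <= 1 / 8 by rewrite irE.
  rewrite !mulrDl mulrBr in ix *; lra.
apply: le_binE => // j; apply: le_binE => // {}j; rewrite /f.
case: j => [|j] /=; first by rewrite mulr0; lra.
by rewrite -!natr1; have := ler0n R j; lra.
Qed.

Lemma separates_sparse m (e1 e2 : R) : 8 * m%:R <= N -> 0 < e2 -> e2 <= 1 -> (1 < m)%N ->
  32 * N * e1 <= m%:R * e2 ^+ 2 -> 150 ^+ 2 * N <= m%:R ^+ 2 * e2 ^+ 4 ->
  exists tau, separates m (fun s => (stat (fun k => k.-1%:R) s <= tau :> R)%R%:R) e1 e2.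
Proof.
move=> mN e20 e21 m1 he1 he2.
set f := fun k : nat => k.-1%:R : R.
pose M := m%:R ^+ 2 / N.
have M0 : 0 < M by rewrite divr_gt0 // exprn_gt0 // ltr0n ltnW.
have MN : M * N = m%:R ^+ 2 by rewrite divfK // gt_eqF.
set E := mean_stat (fun _ : I => u) m f.
have EM : E <= M by exact: mean_collisions_unif.
have E0 : 0 <= E.
  rewrite /E mean_stat_unif // mulr_ge0 // ?ler0n //.
  rewrite -[leLHS](binE_const u m 0 0); apply: le_binE => //; exact: unif_prob.
have Me4 : 150 ^+ 2 <= M * e2 ^+ 4.
  rewrite -(ler_pM2r N0); move: he2; rewrite -MN; lra.
pose G := M * e2 ^+ 2 / 8.
have G0 : 0 < G by rewrite divr_gt0 // mulr_gt0 // exprn_gt0.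
have e24 : e2 ^+ 4 = (e2 ^+ 2) ^+ 2 by rewrite -exprM.
have e2sq : 0 < e2 ^+ 2 <= 1.
  by rewrite exprn_gt0 //= expr_le1 // ltW.
(* The variance bound, twice the mean, has a part in [E], absorbed by [GG], and a part linear in the
   excess over [E], absorbed by [G_large]. *)
have GG : 300 * M <= G ^+ 2.
  have -> : G ^+ 2 = M * (M * e2 ^+ 4) / 64 by rewrite /G e24; field.
  have := ler_wpM2l (ltW M0) Me4; lra.
have G_large : 50 ^+ 2 <= G.
  case/andP: e2sq => s0 s1; have : M * e2 ^+ 4 <= M * e2 ^+ 2.
    by rewrite ler_pM2l // e24 expr2 ger_pMr.
  rewrite /G; lra.
(* A close [p] raises the mean by at most [G / 4] and a far one by at least [G]. *)
exists (E + G / 2) => p pD; split=> [close|far].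
  have diff : mean_stat p m f - E <= G / 4.
    apply: le_trans (mean_stat_close I0 m (b := 1) pD _) _.
      by case=> [|k]; rewrite /f /= ?subrr ?lexx ?ler01 // -natr1; lra.
    rewrite mul1r -/N; apply: le_trans (ler_wpM2l (ler0n R m) close) _.
    rewrite -(ler_pM2l N0) /G.
    have -> : N * (M * e2 ^+ 2 / 8 / 4) = m%:R / 32 * (m%:R * e2 ^+ 2).
      by rewrite /M; field; rewrite gt_eqF.
    by have := ler_wpM2l (ler0n R m) he1; lra.
  have t0 : 0 < G / 4 by rewrite divr_gt0.
  have le_v : multE p m (fun s => (stat f s - mean_stat p m f) ^+ 2) (fun=> 0%N) <=
      2 * (E + G / 4) by apply: le_trans (var_collisions m pD) _; rewrite -/f; lra.
  apply: le_trans (threshold_above pD t0 le_v _); last first.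
    rewrite -/(mean_stat p m f); lra.
  suff : 2 * (E + G / 4) / (G / 4) ^+ 2 <= 1 / 5 by lra.
  rewrite ler_pdivrMr ?exprn_gt0 //; nra.
have diff : G <= mean_stat p m f - E.
  have r0 : (0 : R) < 1 / 4 by lra.
  have := mean_stat_far I0 pD m1 ltr01 r0 e20 _ _ far.
  (* The quadratic branch is the smaller one because [m * e2 <= N / 8]. *)
  rewrite -/N -/u -/E min_l.
    have -> : m%:R ^+ 2 * e2 ^+ 2 / N = M * e2 ^+ 2 by rewrite /M; field; rewrite gt_eqF.
    move=> /(_ f) h; suff : M * e2 ^+ 2 <= 8 * 1 * (mean_stat p m f - E) by rewrite /G; lra.
    apply: h; last by move=> x i; exact: collisions_window.
    by case=> [|k]; rewrite /f /= -?natr1; lra.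
  rewrite ler_pdivrMr //.
  have -> : m%:R ^+ 2 * e2 ^+ 2 = (m%:R * e2) * (m%:R * e2) by ring.
  have -> : m%:R * (1 / 4) * e2 / 2 * N = (m%:R * e2) * (N / 8) by field.
  apply: ler_wpM2l; first by rewrite mulr_ge0 // ltW.
  apply: le_trans (_ : m%:R * 1 <= _); first exact: ler_wpM2l.
  lra.
set mu := mean_stat p m f in diff *.
(* The deviation scales with the actual gap rather than with [G], since the variance bound [2 * mu]
   grows with [mu]. *)
have t0 : 0 < (mu - E) / 2 by rewrite divr_gt0 //; lra.
apply: le_trans (threshold_below pD t0 (var_collisions m pD) _) _.
  rewrite -/f -/(mean_stat p m f) -/mu; lra.
rewrite -/f -/mu ler_pdivrMr ?exprn_gt0 //; nra.
Qed.

(** Here [w ^+ 2] stands for the mean count [m / N]. The slope is [1 / w] from [w ^+ 2 - 5 * w] to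
    [w ^+ 2 + 6 * w], which for [w >= 1] leaves room for a mean off by [3 * w], a deviation of
    [2 * w] and the unit step to [k.+1]. *)
Definition ramp (w : R) (k : nat) : R := Num.max 0 (Num.min 11 ((k%:R - (w ^+ 2 - 5 * w)) / w)).

(* Up to a linear term, a Huber function of [k - w ^+ 2] at scale [w]. *)
Definition huber (w : R) (k : nat) : R := \sum_(j < k) ramp w j.

Lemma huberS w k : huber w k.+1 - huber w k = ramp w k.
Proof. by rewrite /huber big_ord_recr /= addrAC subrr add0r. Qed.

Lemma ramp_bound w k : 0 <= ramp w k <= 11.
Proof. by rewrite /ramp le_max lexx /= ge_max ge_min lexx; rewrite ler0n. Qed.

Lemma ramp_le w k : 0 < w -> ramp w k <= ramp w k.+1.
Proof.
move=> w0; rewrite /ramp ge_max le_max lexx /= le_max; apply/orP; right.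
rewrite le_min ge_min lexx ge_min ler_pM2r ?invr_gt0 // lerD2r ler_nat leqnSn orbT //.
Qed.

(** Within [2 * w] of [mu] the ramp rises by exactly [1 / w]; farther away the left side is
    nonpositive. A quadratic minorant makes a variance estimate sufficient. *)
Lemma rampS_ge w k (mu : R) : 1 <= w -> `|mu - w ^+ 2| <= 3 * w ->
  w^-1 - (k%:R - mu) ^+ 2 / (4 * w ^+ 3) <= ramp w k.+1 - ramp w k.
Proof.
move=> w1; rewrite ler_norml => /andP[mu1 mu2].
have w0 : 0 < w by lra.
have -> : w^-1 - (k%:R - mu) ^+ 2 / (4 * w ^+ 3) = (1 - (k%:R - mu) ^+ 2 / (2 * w) ^+ 2) / w.
  by field; rewrite gt_eqF.
have [big|small] := leP (2 * w) `|k%:R - mu|.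
  apply: le_trans (_ : 0 <= _); last by rewrite subr_ge0 ramp_le.
  rewrite ler_pdivrMr // mul0r subr_le0 ler_pdivlMr ?exprn_gt0 ?mulr_gt0 // mul1r.
  rewrite -[leRHS]real_normK ?num_real // ler_pXn2r ?nnegrE //.
  by rewrite ltW // mulr_gt0.
move: small; rewrite ltr_norml => /andP[k1 k2].
have lin (y : R) : 0 <= y <= 11 * w -> Num.max 0 (Num.min 11 (y / w)) = y / w.
  case/andP=> y0 y1; rewrite min_r ?ler_pdivrMr // max_r //.
  by rewrite divr_ge0 // ltW.
rewrite /ramp -natr1 !lin; [|lra|lra].
rewrite -mulrBl ler_pM2r ?invr_gt0 //.
have := divr_ge0 (sqr_ge0 (k%:R - mu)) (sqr_ge0 (2 * w)).
set q := _ / _ => q0; lra.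
Qed.

(** The hybrid count has mean within [3 * w] of [w ^+ 2] and variance at most [2 * w ^+ 2], so
    [rampS_ge] averages to at least [1 / w - 2 * w ^+ 2 / (4 * w ^+ 3)]. *)
Lemma huber_window m w x (i : nat) (f := huber w) :
  m%:R = w ^+ 2 * N -> 1 <= w -> (1 < m)%N -> 0 <= x <= 1 -> (i <= m - 2)%N ->
  i%:R * `|x - u| <= w / 4 ->
  (2 * w)^-1 <= binE x i (binE u (m - 2 - i) (fun j => (f j.+2 - f j.+1) - (f j.+1 - f j))) 0.
Proof.
move=> mE w1 m1 hx im le_i; have hu : 0 <= u <= 1 := unif_prob R I0.
set r := (m - 2 - i)%N; pose mu := i%:R * x + r%:R * u.
have w0 : 0 < w by lra.
(* The [2 * u] accounts for the two trials consumed by the second difference. *)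
have muE : mu - w ^+ 2 = i%:R * (x - u) - 2 * u.
  have ir : (i + r + 2 = m)%N by rewrite /r; clear -im m1; lia.
  have irE : i%:R + r%:R + 2 = m%:R :> R by rewrite -!natrD ir.
  have -> : w ^+ 2 = (i%:R + r%:R + 2) * u by rewrite irE mE mulfK // gt_eqF.
  by rewrite /mu; ring.
have near : `|mu - w ^+ 2| <= 2 + w / 4.
  rewrite muE; apply: le_trans (ler_normB _ _) _; rewrite normrM ger0_norm ?ler0n // addrC.
  apply: lerD => //; case/andP: hu => u0 u1; rewrite ger0_norm; lra.
have near3 : `|mu - w ^+ 2| <= 3 * w by lra.
have mu_le : mu <= 2 * w ^+ 2.
  have := ler_wpM2l (ler0n R i) (ler_norm (x - u)); case/andP: hu => u0 u1; nra.
apply: le_trans (_ : binE x i (binE u r (fun j => - (4 * w ^+ 3)^-1 * (j%:R - mu) ^+ 2 + w^-1)) 0 <= _).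
  rewrite (@eq_binE _ _ _ _ (fun j => - (4 * w ^+ 3)^-1 * binE u r (fun j => (j%:R - mu) ^+ 2) j + w^-1)); last first.
    by move=> j; rewrite binE_affine.
  rewrite binE_affine.
  have := binE_hybrid_sqr I0 i r hx; rewrite -/N -/u -/mu => /le_trans/(_ mu_le).
  set V := binE _ _ _ _ => leV.
  have c0 : 0 <= (4 * w ^+ 3)^-1 by rewrite invr_ge0 mulr_ge0 // exprn_ge0 // ltW.
  have := ler_wpM2l c0 leV.
  have -> : (4 * w ^+ 3)^-1 * (2 * w ^+ 2) = w^-1 / 2 by field; rewrite gt_eqF.
  have -> : (2 * w)^-1 = w^-1 / 2 by field; rewrite gt_eqF.
  lra.
apply: le_binE => // j; apply: le_binE => // {}j.
rewrite !huberS; apply: le_trans (rampS_ge j w1 near3).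
by rewrite addrC mulNr mulrC.
Qed.

Lemma separates_dense m w (e1 e2 : R) :
  m%:R = w ^+ 2 * N -> 1 <= w -> (1 < m)%N -> 0 <= e1 -> 0 < e2 ->
  (11 * 2 ^+ 8) * e1 <= e2 -> (11 * 2 ^+ 5) * e1 <= w * e2 ^+ 2 ->
  10 ^+ 8 <= m%:R * e2 ^+ 2 -> 10 ^+ 8 <= m%:R * w ^+ 2 * e2 ^+ 4 ->
  exists tau, separates m (fun s => (stat (huber w) s <= tau :> R)%R%:R) e1 e2.
Proof.
move=> mE w1 m1 e10 e20 he1 he1w hm hmw.
set f := huber w; set E := mean_stat (fun _ : I => u) m f.
have w0 : 0 < w by lra.
have m0 : 0 < m%:R :> R by rewrite ltr0n ltnW.
(* The two branches of [mean_stat_far] at [r = w / 4], after factoring out [m * e2 * w] with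
   [m / N = w ^+ 2]. *)
pose D := Num.min (w * e2) (1 / 8).
pose G := m%:R * e2 * D / 8.
have D0 : 0 < D by rewrite lt_min mulr_gt0 //; lra.
have G0 : 0 < G by rewrite divr_gt0 ?mulr_gt0.
(* Against the variance bound [11 ^+ 2 * m], the close side needs
   [16 * 11 ^+ 2 / 10 ^+ 4 <= 1 / 5]. *)
have GG : 10 ^+ 4 * m%:R <= G ^+ 2.
  rewrite /G /D; have [_|_] := leP (w * e2) (1 / 8).
    have -> : (m%:R * e2 * (w * e2) / 8) ^+ 2 = m%:R * (m%:R * w ^+ 2 * e2 ^+ 4) / 64 by field.
    have := ler_wpM2l (ltW m0) hmw; lra.
  have -> : (m%:R * e2 * (1 / 8) / 8) ^+ 2 = m%:R * (m%:R * e2 ^+ 2) / (2 ^+ 12) by field.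
  have := ler_wpM2l (ltW m0) hm; lra.
have fb k : 0 <= f k.+1 - f k <= 11 by rewrite huberS ramp_bound.
have b0 : (0 : R) <= 11 by [].
exists (E + G / 2) => p pD.
have le_v : multE p m (fun s => (stat f s - mean_stat p m f) ^+ 2) (fun=> 0%N) <=
  11 ^+ 2 * m%:R := var_stat_lipschitz m pD b0 fb.
split=> [close|far].
  have diff : mean_stat p m f - E <= G / 4.
    apply: le_trans (mean_stat_close I0 m pD fb) _; rewrite -/N.
    apply: le_trans (_ : 11 * m%:R * e1 <= _); first by rewrite ler_wpM2l ?mulr_ge0.
    have eD : (11 * 2 ^+ 5) * e1 <= e2 * D by rewrite /D; case: (leP (w * e2) (1 / 8)) => _; lra.
    by have := ler_wpM2l (ltW m0) eD; rewrite /G; lra.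
  have t0 : 0 < G / 4 by rewrite divr_gt0.
  apply: le_trans (threshold_above pD t0 le_v _); last first.
    rewrite -/(mean_stat p m f); lra.
  suff : 11 ^+ 2 * m%:R / (G / 4) ^+ 2 <= 1 / 5 by lra.
  rewrite ler_pdivrMr ?exprn_gt0 //; lra.
have diff : G <= mean_stat p m f - E.
  have r0 : (0 : R) < w / 4 by lra.
  have := mean_stat_far I0 pD m1 w0 r0 e20 _ _ far.
  move=> /(_ f) h.
  have w80 : 0 < w^-1 / 8 by rewrite divr_gt0 ?invr_gt0.
  have -> : G = w^-1 / 8 * (m%:R * e2 * w * D) by rewrite /G; field; rewrite gt_eqF.
  suff : m%:R * e2 * w * D <= 8 * w * (mean_stat p m f - E).
    by rewrite -(ler_pM2l w80) => /le_trans; apply; rewrite le_eqVlt; apply/orP; left; apply/eqP; field; rewrite gt_eqF.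
  apply: le_trans (h _ _); last 1 first.
  - by move=> x i; exact: huber_window.
  - rewrite -/N /D minr_pMr ?mulr_ge0 ?(ltW w0) ?(ltW e20) //.
    have -> : m%:R ^+ 2 * e2 ^+ 2 / N = m%:R * e2 * w * (w * e2).
      by rewrite expr2 {2}mE; field; rewrite gt_eqF.
    by rewrite (_ : m%:R * (w / 4) * e2 / 2 = m%:R * e2 * w * (1 / 8)) //; field.
  by move=> j; rewrite !huberS subr_ge0 ramp_le.
have t0 : 0 < G / 2 by rewrite divr_gt0.
apply: le_trans (threshold_below pD t0 le_v _) _.
  rewrite -/(mean_stat p m f); lra.
rewrite ler_pdivrMr ?exprn_gt0 //; lra.
Qed.

End Regimes.

(** * From sample sequences to histograms, through a randomizing kernel *)

Section Sampling.
Variables (R : realFieldType) (J : finType).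
Implicit Types (p : J -> R) (G : seq J -> R).

Fixpoint seqE p m G : R :=
  if m is m'.+1 then \sum_i p i * seqE p m' (fun s => G (i :: s)) else G [::].

Lemma seqE_sum p m (X : finType) (k : X -> R) (H : X -> seq J -> R) :
  seqE p m (fun s => \sum_x k x * H x s) = \sum_x k x * seqE p m (H x).
Proof.
elim: m H => [|m IHm] H //=.
under eq_bigr do rewrite IHm mulr_sumr.
rewrite exchange_big; apply: eq_bigr => x _; rewrite mulr_sumr.
by apply: eq_bigr => i _; rewrite mulrCA.
Qed.

Lemma sum_tuples p m G : \sum_(t : m.-tuple J) (\prod_(j <- t) p j) * G t = seqE p m G.
Proof.
elim: m G => [|m IHm] G /=.
  rewrite (big_pred1 [tuple]) ?big_nil ?mul1r // => t.
  by apply/esym/eqP/val_inj; case: t => [[]].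
rewrite (reindex (fun it : J * m.-tuple J => cons_tuple it.1 it.2)) /=; last first.
  exists (fun t => (thead t, behead_tuple t)) => [[i t] _|t _] /=.
    by congr (_, _); apply: val_inj.
  by apply: val_inj; case/tupleP: t => y t; rewrite /= theadE.
rewrite -(pair_big xpredT xpredT
  (fun i (t : m.-tuple J) => (\prod_(j <- i :: t) p j) * G (i :: t))) /=.
apply: eq_bigr => i _; rewrite -IHm mulr_sumr; apply: eq_bigr => t _.
by rewrite big_cons mulrA.
Qed.

Lemma sum_samples p m G :
  \sum_(s : {ffun 'I_m -> J}) (\prod_(j < m) p (s j)) * G (tuple_of_finfun s) = seqE p m G.
Proof.
rewrite -sum_tuples (reindex (@finfun_of_tuple J m)); last first.
  by exists (@tuple_of_finfun J m) => t _; rewrite ?finfun_of_tupleK ?tuple_of_finfunK.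
apply: eq_bigr => t _; rewrite finfun_of_tupleK big_tuple; congr (_ * _).
by apply: eq_bigr => j _; rewrite ffunE.
Qed.

Section Kernel.
Variables (I : finType) (K : J -> I -> R).

(** The tester's internal randomness: given the samples [s], each is independently replaced by a
    cell drawn from [K], and [F] is averaged over the resulting histogram. *)
Fixpoint kernelE (F : (I -> nat) -> R) (s : seq J) c : R :=
  if s is i :: s' then \sum_x K i x * kernelE F s' (incr c x) else F c.

Lemma seqE_kernel p m F c :
  seqE p m (fun s => kernelE F s c) = multE (fun x => \sum_i p i * K i x) m F c.
Proof.
elim: m c => [|m IHm] c //=.
under eq_bigr do rewrite seqE_sum mulr_sumr.
rewrite exchange_big; apply: eq_bigr => x _; rewrite mulr_suml.
by apply: eq_bigr => i _; rewrite IHm mulrA.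
Qed.

Hypothesis KD : forall i, distr (K i).

Lemma kernelE_bound F s c : (forall c', 0 <= F c' <= 1) -> 0 <= kernelE F s c <= 1.
Proof.
move=> F01; elim: s c => [|i s IHs] c //=; case: (KD i) => K0 K1.
rewrite sumr_ge0 => [|x _]; last by rewrite mulr_ge0 //; case/andP: (IHs (incr c x)).
rewrite -[leRHS]K1; apply: ler_sum => x _; rewrite -[leRHS]mulr1; apply: ler_wpM2l => //.
by case/andP: (IHs (incr c x)).
Qed.

Lemma distr_kernel p : distr p -> distr (fun x => \sum_i p i * K i x).
Proof.
move=> [p0 p1]; split=> [x|]; first by apply: sumr_ge0 => i _; rewrite mulr_ge0 //; case: (KD i).
rewrite exchange_big -[RHS]p1; apply: eq_bigr => i _.
by rewrite -mulr_sumr (KD i).2 mulr1.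
Qed.
End Kernel.
End Sampling.

(** * Choice of the sample size for uniformity testing *)

Section Uniformity.
Variable R : archiRcfType.

(** The sparse sample size is tried first. If it exceeds [N / 8], then [N] itself is within a
    constant factor of the budget, so the dense tester is affordable. *)
Lemma uniformity_tester (I : finType) (e1 e2 : R) (N : R := #|I|%:R) :
  (0 < #|I|)%N -> 0 < e2 -> e2 <= 1 -> 0 <= e1 -> 11 * 2 ^+ 8 * e1 <= e2 ->
  exists m : nat,
    m%:R <= 10 ^+ 9 * (N * (e1 / e2 ^+ 2) ^+ 2 + N * (e1 / e2 ^+ 2) + Num.sqrt N / e2 ^+ 2) /\
    exists T : (I -> nat) -> R, (forall s, 0 <= T s <= 1) /\ separates m T e1 e2.
Proof.
move=> I0 e20 e21 e10 e12.
have N1 : 1 <= N by rewrite (ler_nat R 1).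
have N0 : 0 < N by lra.
set s := Num.sqrt N / e2 ^+ 2; set a := e1 / e2 ^+ 2.
have e2s0 : 0 < e2 ^+ 2 by rewrite exprn_gt0.
have e2s1 : e2 ^+ 2 <= 1 by rewrite expr_le1 // ltW.
have a0 : 0 <= a by rewrite divr_ge0 // ltW.
have aE : a * e2 ^+ 2 = e1 by rewrite divfK // gt_eqF.
have sE : s * e2 ^+ 2 = Num.sqrt N by rewrite divfK // gt_eqF.
have sN : s ^+ 2 * e2 ^+ 4 = N.
  rewrite -[X in e2 ^+ X]/(2 * 2)%N exprM -exprMn sE sqr_sqrtr // ltW //.
have sqrtN1 : 1 <= Num.sqrt N by rewrite -[leLHS]sqrtr1 ler_sqrt.
have s1 : 1 <= s by rewrite ler_pdivlMr // mul1r; lra.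
have s0 : 0 < s by lra.
have e24 : 0 < e2 ^+ 4 by rewrite exprn_gt0.
have thr01 (F : (I -> nat) -> R) tau c : 0 <= ((F c <= tau)%R%:R : R) <= 1.
  by case: (F c <= tau); rewrite lexx ler01.
(* The [a] term gives the closeness condition of [separates_sparse]; the [s] term gives its
   concentration condition, as [s ^+ 2 * e2 ^+ 4 = N]. *)
pose XA := 32 * N * a + 150 * s.
have Na0 : 0 <= N * a by rewrite mulr_ge0 // ltW.
have Naa0 : 0 <= N * a ^+ 2 by rewrite mulr_ge0 ?sqr_ge0 // ltW.
pose mA := (Num.truncn XA).+1.
have mAgt : XA < mA%:R by exact: truncnS_gt.
have XA0 : 0 <= XA by rewrite /XA; lra.
have mAle : mA%:R <= XA + 1.
  by rewrite -natr1 lerD2r truncn_le.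
have mA1 : (1 < mA)%N by rewrite -(ltr_nat R); rewrite /XA in mAgt; lra.
have [sparse|dense] := leP (8 * mA%:R) N.
  exists mA; split; first by rewrite /XA in mAle; lra.
  have c1 : 32 * N * e1 <= mA%:R * e2 ^+ 2.
    rewrite -aE mulrA ler_pM2r //; rewrite /XA in mAgt; lra.
  have c2 : 150 ^+ 2 * N <= mA%:R ^+ 2 * e2 ^+ 4.
    rewrite -{1}sN mulrA ler_pM2r // -exprMn ler_pXn2r ?nnegrE ?ler0n //; last by lra.
    by rewrite /XA in mAgt; lra.
  have [tau sep] := separates_sparse I0 sparse e20 e21 mA1 c1 c2.
  by eexists; split; last exact: sep.
(* The three terms give [w >= 1], then [11 * 2 ^+ 5 * a <= w], then the two concentration conditions
   of [separates_dense]. *)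
pose XB := N + (11 * 2 ^+ 5) ^+ 2 * (N * a ^+ 2) + 10 ^+ 8 * s.
pose mB := (Num.truncn XB).+1.
have XB0 : 0 <= XB by rewrite /XB; lra.
have mBgt : XB < mB%:R by exact: truncnS_gt.
have mBle : mB%:R <= XB + 1 by rewrite -natr1 lerD2r truncn_le.
have mB1 : (1 < mB)%N by rewrite -(ltr_nat R); rewrite /XB in mBgt; lra.
have mBpos : 0 < mB%:R :> R by rewrite ltr0n.
exists mB; split.
  rewrite /XB in mBle; rewrite /XA in mAle; lra.
pose w := Num.sqrt (mB%:R / N).
have w2 : w ^+ 2 = mB%:R / N by rewrite sqr_sqrtr // divr_ge0 // ltW.
have mE : mB%:R = w ^+ 2 * N by rewrite w2 divfK // gt_eqF.
have w0 : 0 <= w by exact: sqrtr_ge0.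
have w1 : 1 <= w.
  rewrite -[leLHS]sqrtr1 ler_sqrt ?divr_ge0 ?(ltW N0) // ler_pdivlMr // mul1r.
  by rewrite /XB in mBgt; lra.
have wa : 11 * 2 ^+ 5 * a <= w.
  have : (11 * 2 ^+ 5 * a) ^+ 2 <= w ^+ 2.
    by rewrite w2 exprMn ler_pdivlMr //; rewrite /XB in mBgt; lra.
  by rewrite ler_pXn2r ?nnegrE //; lra.
have c1 : 11 * 2 ^+ 5 * e1 <= w * e2 ^+ 2 by rewrite -aE mulrA ler_pM2r.
have ms : 10 ^+ 8 * s <= mB%:R by rewrite /XB in mBgt; lra.
have c2 : 10 ^+ 8 <= mB%:R * e2 ^+ 2.
  apply: le_trans (_ : 10 ^+ 8 * s * e2 ^+ 2 <= _); last by rewrite ler_pM2r.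
  by rewrite -mulrA sE ler_peMr // exprn_ge0.
have c3 : 10 ^+ 8 <= mB%:R * w ^+ 2 * e2 ^+ 4.
  rewrite w2 (_ : _ * _ = mB%:R ^+ 2 * e2 ^+ 4 / N); last by ring.
  rewrite ler_pdivlMr // -[in leLHS]sN mulrA ler_pM2r //.
  apply: le_trans (_ : (10 ^+ 8 * s) ^+ 2 <= _); last first.
    by rewrite ler_pXn2r ?nnegrE // mulr_ge0 ?exprn_ge0 // ltW.
  rewrite [leRHS]exprMn ler_pM2r ?exprn_gt0 //.
  by rewrite expr2 ler_peMr ?exprn_ge0 // exprn_ege1 // (ler_nat R 1).
have [tau sep] := separates_dense I0 mE w1 mB1 e10 e20 e12 c1 c2 c3.
by eexists; split; last exact: sep.
Qed.
End Uniformity.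

(** * Reduction of identity testing to uniformity testing *)

Section Flattening.
Variables (R : archiRealFieldType) (n : nat) (q : 'I_n -> R).
Hypotheses (n0 : (0 < n)%N) (qD : distr q).

Definition grains (i : 'I_n) : nat := (Num.truncn (n%:R * q i)).+1.
Definition grain : finType := {i : 'I_n & 'I_(grains i)}.

(* Half of the mass of [i] is spread over the grains of [i]; the other half is spread
   independently of [i] over all grains, so as to map [q] to the uniform distribution. *)
Definition flatten_kernel (i : 'I_n) (y : grain) : R :=
  (tag y == i)%:R / (2 * (grains i)%:R) + (#|grain|%:R^-1 - q (tag y) / (2 * (grains (tag y))%:R)).

Let grains0 i : 0 < (grains i)%:R :> R.
Proof. by rewrite ltr0n. Qed.

Lemma sum_grain (h : 'I_n -> R) : \sum_(y : grain) h (tag y) = \sum_i (grains i)%:R * h i.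
Proof.
rewrite -(sig_big_dep xpredT (fun=> xpredT) (fun i (_ : 'I_(grains i)) => h i)) /=.
by apply: eq_bigr => i _; rewrite sumr_const card_ord mulr_natl.
Qed.

Lemma card_grain : #|grain|%:R = \sum_i (grains i)%:R :> R.
Proof.
rewrite -sum1_card natr_sum (sum_grain (fun=> 1)).
by apply: eq_bigr => i _; rewrite mulr1.
Qed.

Lemma card_grain_ge : n%:R <= #|grain|%:R :> R.
Proof.
rewrite card_grain -[n in leLHS](card_ord n) -sum1_card natr_sum.
by apply: ler_sum => i _; rewrite ler_nat.
Qed.

Lemma card_grain_le : #|grain|%:R <= 2 * n%:R :> R.
Proof.
rewrite card_grain; apply: le_trans (_ : \sum_i (n%:R * q i + 1) <= _).
  apply: ler_sum => i _; rewrite -natr1 lerD2r truncn_le.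
  by rewrite mulr_ge0 //; case: qD.
by rewrite big_split /= -mulr_sumr qD.2 sumr_const card_ord mulr1 mulrDl mul1r.
Qed.

Lemma grain_gt0 : (0 < #|grain|)%N.
Proof. by rewrite -(ltr_nat R) (lt_le_trans _ card_grain_ge) // ltr_nat. Qed.

Lemma distr_flatten i : distr (flatten_kernel i).
Proof.
have N0 : 0 < #|grain|%:R :> R by rewrite ltr0n grain_gt0.
split=> [y|].
  (* [n * q j < grains j] and [N <= 2 * n] bound the subtracted share [q j / (2 * grains j)] by
     [1 / N]. *)
  rewrite addr_ge0 ?divr_ge0 ?mulr_ge0 ?ler0n // subr_ge0.
  set j := tag y; rewrite ler_pdivrMr ?mulr_gt0 // ler_pdivlMl //.
  have := truncnS_gt (n%:R * q j); rewrite -/(grains j) => lt_q.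
  by have := ler_wpM2r (qD.1 j) card_grain_le; lra.
rewrite (sum_grain (fun j => (j == i)%:R / (2 * (grains i)%:R) +
  (#|grain|%:R^-1 - q j / (2 * (grains j)%:R)))).
under eq_bigr do rewrite mulrDr mulrBr.
rewrite big_split sumrB /= -mulr_suml -card_grain divff ?gt_eqF //.
rewrite (bigD1 i) //= eqxx big1 => [|j ji]; last by rewrite (negPf ji) mul0r mulr0.
rewrite (eq_bigr (fun j => q j / 2)); last by move=> j _; field; rewrite gt_eqF.
by rewrite -mulr_suml qD.2 /=; field; rewrite gt_eqF.
Qed.

(** The part of the kernel independent of the input contributes the same for every [p]; what remains
    is [(p i - q i) / (2 * grains i)] on each of the [grains i] grains of [i]. *)
Lemma flatten_l1 p : distr p ->
  \sum_y `|\sum_i p i * flatten_kernel i y - #|grain|%:R^-1| = (\sum_i `|p i - q i|) / 2.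
Proof.
move=> pD.
have pK y : \sum_i p i * flatten_kernel i y - #|grain|%:R^-1 =
  (p (tag y) - q (tag y)) / (2 * (grains (tag y))%:R).
  under eq_bigr do rewrite mulrDr.
  rewrite big_split /= -mulr_suml pD.2 (bigD1 (tag y)) //= eqxx big1 => [|j ji].
    rewrite /=; ring.
  by rewrite eq_sym (negPf ji) mul0r mulr0.
under eq_bigr do rewrite pK.
rewrite (sum_grain (fun j => `|(p j - q j) / (2 * (grains j)%:R)|)) mulr_suml.
apply: eq_bigr => i _; rewrite normrM [`|_^-1|]gtr0_norm ?invr_gt0 ?mulr_gt0 //.
by field; rewrite gt_eqF.
Qed.
End Flattening.

Theorem theorem2p1 :
  exists c C : Rdefinitions.R, 0 < c /\ 0 < C /\
  forall (n : nat) (q : 'I_n -> Rdefinitions.R) (eps1 eps2 : Rdefinitions.R),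
    (1 <= n)%N -> is_distr q ->
    0 < eps2 -> eps2 <= 1 -> 0 <= eps1 -> eps1 <= c * eps2 ->
    exists m : nat,
      m%:R <= C * (n%:R * (eps1 / eps2 ^+ 2) ^+ 2 + n%:R * (eps1 / eps2 ^+ 2)
                   + Num.sqrt (n%:R) / eps2 ^+ 2) /\
      exists T : {ffun 'I_m -> 'I_n} -> Rdefinitions.R,
        (forall s, 0 <= T s <= 1) /\
        forall p : 'I_n -> Rdefinitions.R, is_distr p ->
          (l1dist p q <= eps1 -> 4 / 5 <= accept_prob p T) /\
          (eps2 <= l1dist p q -> 4 / 5 <= 1 - accept_prob p T).
Proof.
(* [c] is the ratio required by [uniformity_tester]. Flattening halves both parameters, which
   doubles [eps1 / eps2 ^+ 2] and quadruples [1 / eps2 ^+ 2]; with at most [2 * n] grains this costs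
   a factor of at most 8 in [C]. *)
exists (11 * 2 ^+ 8)^-1, (8 * 10 ^+ 9); split; first by rewrite invr_gt0; lra.
split; first by lra.
move=> n q e1 e2 n1 qD e20 e21 e10 e12.
have [||||m [m_le [T' [T'01 sep]]]] := @uniformity_tester _ (grain q) (e1 / 2) (e2 / 2) (grain_gt0 q n1).
- by rewrite divr_gt0.
- by lra.
- by rewrite divr_ge0.
- by move: e12; rewrite ler_pdivlMl //; lra.
pose T (s : {ffun 'I_m -> 'I_n}) := kernelE (@flatten_kernel _ n q) T' (tuple_of_finfun s) (fun=> 0%N).
have TE p : accept_prob p T =
    multE (fun y => \sum_i p i * flatten_kernel i y) m T' (fun=> 0%N).
  by rewrite -seqE_kernel -sum_samples.
exists m; split.
  apply: le_trans m_le _.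
  have N2 := card_grain_le qD.
  have sN2 : Num.sqrt (#|grain q|%:R : Rdefinitions.R) <= 2 * Num.sqrt n%:R.
    apply: le_trans (_ : Num.sqrt (2 ^+ 2 * n%:R) <= _).
      rewrite ler_sqrt; last by rewrite mulr_ge0 ?exprn_ge0.
      by apply: le_trans N2 _; rewrite ler_wpM2r // expr2; lra.
    by rewrite sqrtrM ?exprn_ge0 // sqrtr_sqr ger0_norm.
  set s := Num.sqrt _ in sN2 *; set s' := Num.sqrt n%:R in sN2 *; set N := #|_|%:R in N2 *.
  have -> : e1 / 2 / (e2 / 2) ^+ 2 = 2 * (e1 / e2 ^+ 2) by field; rewrite gt_eqF.
  have -> : s / (e2 / 2) ^+ 2 = 4 * (s / e2 ^+ 2) by field; rewrite gt_eqF.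
  set a := e1 / e2 ^+ 2.
  have a0 : 0 <= a by rewrite divr_ge0 // exprn_ge0 // ltW.
  have na0 : 0 <= n%:R * a by rewrite mulr_ge0.
  have Na : N * a <= 2 * n%:R * a by rewrite ler_wpM2r.
  have Naa : N * a ^+ 2 <= 2 * n%:R * a ^+ 2 by rewrite ler_wpM2r ?sqr_ge0.
  have sN : s / e2 ^+ 2 <= 2 * s' / e2 ^+ 2.
    by rewrite ler_wpM2r // invr_ge0 exprn_ge0 // ltW.
  rewrite [8 * _]mulrC -[leRHS]mulrA ler_wpM2l ?exprn_ge0 // exprMn; lra.
exists T; split=> [s|p pD].
  by apply: kernelE_bound => // i; apply: distr_flatten.
have [close far] := sep _ (distr_kernel (distr_flatten n1 qD) pD).
rewrite TE; rewrite (flatten_l1 q pD) in close far.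
split=> d; first by apply: close; rewrite ler_pM2r ?invr_gt0.
suff : e2 / 2 <= (\sum_i `|p i - q i|) / 2 by move=> /far; lra.
by rewrite ler_pM2r ?invr_gt0.
Qed.
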